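(* Let $X$ and $Y$ be locally ordered simplicial complexes, $(E,\nabla)$ a discrete vector bundle with connection over $X$, and $f\colon Y\to X$ an order-preserving abstract simplicial map. Consider the operations $$d_\nabla\colon C^k(X;E)\to C^{k+1}(X;E),\qquad \smile\colon C^k(X;E)\times C^l(X)\to C^{k+l}(X;E),$$ $$\smile\colon C^k(X;\mathrm{Hom}(E))\times C^l(X;E)\to C^{k+l}(X;E),\qquad d_{\nabla^{\mathrm{Hom}}}\colon C^k(X;\mathrm{Hom}(E))\to C^{k+1}(X;\mathrm{Hom}(E)),$$ $$F\in C^2(X;\mathrm{Hom}(E)),\qquad f^*\colon C^k(X;E)\to C^k(Y;f^*E)$$ defined in the context. For all $k,l\ge 0$, $\alpha\in C^k(X;E)$ and $w\in C^l(X)$: (i) (Leibniz rule) $d_\nabla(\alpha\smile w)=d_\nabla\alpha\smile w+(-1)^k\,\alpha\smile dw$; (ii) (naturality) $f^*(\alpha\smile w)=f^*\alpha\smile f^*w$ and $f^*d_\nabla=d_{f^*\nabla}f^*$; (iii) $d_\nabla d_\nabla\alpha=F\smile\alpha$ (so $F$ represents the operator $d_\nabla\circ d_\nabla$); (iv) (Bianchi identity) $d_{\nabla^{\mathrm{Hom}}}F=0$.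
   Context: A locally ordered simplicial complex $X$ is a finite abstract simplicial complex together with a reflexive antisymmetric relation $\le$ on its vertex set that restricts to a total order on the vertices of each simplex. $X_k$ is the set of $k$-simplices. A $k$-simplex with vertices $v_0<\dots<v_k$ is written $[v_0,\dots,v_k]$, and for a general $k$-simplex we abbreviate its ordered vertices as $0<1<\dots<k$ and write $[0,\dots,k]$; its lowest vertex is the origin vertex. A hat denotes an omitted vertex. An order-preserving simplicial map is a map of vertices sending simplices to simplices and satisfying $f(v)\le f(w)$ whenever $v\le w$. A (real or complex) discrete vector bundle with connection $(E,\nabla)$ over $X$ consists of a finite-dimensional vector space $E_i$ for each vertex $i$ and an invertible linear map $U_{ji}\colon E_i\to E_j$ for each edge $\{i,j\}$, with $U_{ij}=U_{ji}^{-1}$. $C^k(X;E)$ is the space of $E$-valued $k$-cochains: $\alpha$ assigns to each $k$-simplex $[v_0,\dots,v_k]$ a vector $\langle\alpha,[v_0,\dots,v_k]\rangle\in E_{v_0}$ (extended to other orderings of the vertices by the sign of the permutation). $C^l(X)$ is the space of ordinary real-valued simplicial $l$-cochains with usual coboundary $d$. $C^k(X;\mathrm{Hom}(E))$ is the space of homomorphism-valued $k$-cochains: $B$ assigns to each $k$-simplex $[v_0,\dots,v_k]$ a linear map $\langle B,[v_0,\dots,v_k]\rangle\colon E_{v_k}\to E_{v_0}$. Operations: - $\langle d_\nabla\alpha,[0,\dots,k+1]\rangle=U_{01}\langle\alpha,[1,\dots,k+1]\rangle+\sum_{i=1}^{k+1}(-1)^i\langle\alpha,[0,\dots,\hat i,\dots,k+1]\rangle$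 for $\alpha\in C^k(X;E)$. - $\langle\alpha\smile w,[0,\dots,k+l]\rangle=\langle\alpha,[0,\dots,k]\rangle\,\langle w,[k,\dots,k+l]\rangle$ for $\alpha\in C^k(X;E)$, $w\in C^l(X)$. - $\langle B\smile\alpha,[0,\dots,k+l]\rangle=\langle B,[0,\dots,k]\rangle\,\langle\alpha,[k,\dots,k+l]\rangle$ for $B\in C^k(X;\mathrm{Hom}(E))$, $\alpha\in C^l(X;E)$. - $\langle d_{\nabla^{\mathrm{Hom}}}B,[0,\dots,k+1]\rangle=U_{01}\langle B,[1,\dots,k+1]\rangle+\sum_{i=1}^{k}(-1)^i\langle B,[0,\dots,\hat i,\dots,k+1]\rangle+(-1)^{k+1}\langle B,[0,\dots,k]\rangle\,U_{k,k+1}$ for $B\in C^k(X;\mathrm{Hom}(E))$. - The discrete curvature $F\in C^2(X;\mathrm{Hom}(E))$ is $\langle F,[0,1,2]\rangle=U_{01}U_{12}-U_{02}$. - The pullback bundle $f^*(E,\nabla)=(f^*E,f^*\nabla)$ over $Y$ has fibers $(f^*E)_i=E_{f(i)}$ and parallel transport, for each edge $[i,j]$ of $Y$, equal to $U_{f(i)f(j)}$ if $f(i)\ne f(j)$ and to the identity if $f(i)=f(j)$; $d_{f^*\nabla}$ is its exterior covariant derivative. The pullback of $\alpha\in C^k(X;E)$ is $\langle f^*\alpha,[0,\dots,k]\rangle=\langle\alpha,[f(0),\dots,f(k)]\rangle$ if $f([0,\dots,k])$ is a $k$-simplex of $X$, and $0$ otherwise; $f^*w$ for $w\in C^l(X)$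 is the usual cochain pullback, defined by the same formula. *)

(* Defs.v *)
From HB Require Import structures.
From mathcomp Require Import all_boot all_order all_algebra.
From mathcomp Require Import reals complex.
Set Implicit Arguments.
Unset Strict Implicit.
Unset Printing Implicit Defensive.
Import GRing.Theory.
Local Open Scope ring_scope.

(* Dependent finite functions into left modules, with pointwise operations. *)
Section DffunModule.
Variables (K : fieldType) (I : finType) (V : I -> lmodType K).
Local Notation T := {dffun forall i : I, V i}.
Implicit Types (a : K) (u v w : T).

Definition dffun_zero : T := [ffun i => 0].
Definition dffun_opp u : T := [ffun i => - u i].
Definition dffun_add u v : T := [ffun i => u i + v i].
Definition dffun_scale a u : T := [ffun i => a *: u i].

Fact dffun_addA : associative dffun_add.
Proof. by move=> u v w; apply/ffunP => i; rewrite !ffunE addrA. Qed.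
Fact dffun_addC : commutative dffun_add.
Proof. by move=> u v; apply/ffunP => i; rewrite !ffunE addrC. Qed.
Fact dffun_add0 : left_id dffun_zero dffun_add.
Proof. by move=> u; apply/ffunP => i; rewrite !ffunE add0r. Qed.
Fact dffun_addN : left_inverse dffun_zero dffun_opp dffun_add.
Proof. by move=> u; apply/ffunP => i; rewrite !ffunE addNr. Qed.

HB.instance Definition _ := GRing.isZmodule.Build T
  dffun_addA dffun_addC dffun_add0 dffun_addN.

Fact dffun_scaleA a b u :
  dffun_scale a (dffun_scale b u) = dffun_scale (a * b) u.
Proof. by apply/ffunP => i; rewrite !ffunE scalerA. Qed.
Fact dffun_scale1 : left_id 1 dffun_scale.
Proof. by move=> u; apply/ffunP => i; rewrite !ffunE scale1r. Qed.
Fact dffun_scaleDr : right_distributive dffun_scale +%R.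
Proof. by move=> a u v; apply/ffunP => i; rewrite !ffunE scalerDr. Qed.
Fact dffun_scaleDl u : {morph dffun_scale^~ u : a b / a + b}.
Proof. by move=> a b; apply/ffunP => i; rewrite !ffunE scalerDl. Qed.

HB.instance Definition _ := GRing.Zmodule_isLmodule.Build K T
  dffun_scaleA dffun_scale1 dffun_scaleDr dffun_scaleDl.
End DffunModule.

Variant ground := RealGround | ComplexGround.

Definition scalars (R : realType) (g : ground) : fieldType :=
  match g with RealGround => R | ComplexGround => R[i] end.

Definition of_real (R : realType) (g : ground) : {rmorphism R -> scalars R g} :=
  match g return {rmorphism R -> scalars R g} with
  | RealGround => idfun
  | ComplexGround => real_complex R
  end.

(* The empty set is not counted as a simplex; every element of [vert] is a
   vertex. *)
Record lo_complex := LOComplex {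
  vert :> finType;
  vle : rel vert;
  simplices : {set {set vert}};
  simplices_neq0 : set0 \notin simplices;
  simplices_vert : forall v : vert, [set v] \in simplices;
  simplices_sub : forall s t : {set vert},
    s \in simplices -> t \subset s -> t != set0 -> t \in simplices;
  vle_refl : reflexive vle;
  vle_anti : antisymmetric vle;
  vle_trans : forall s : {set vert}, s \in simplices ->
    {in s & &, transitive vle};
  vle_total : forall s : {set vert}, s \in simplices -> {in s &, total vle}
}.

Definition vlt (X : lo_complex) : rel X := fun v w => (v != w) && vle v w.

(* A k-simplex is given by its vertices listed in increasing order, that is, as
   [v_0, ..., v_k] with v_0 < ... < v_k; this list determines, and is
   determined by, the underlying set. Cochains are given by their values on
   these lists; their values on the other orderings of the vertices, fixed by
   the sign of the permutation, are never used. *)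
Definition is_simplex (X : lo_complex) (k : nat) (v : {ffun 'I_k.+1 -> X}) :=
  [forall i : 'I_k.+1, forall j : 'I_k.+1, (i < j)%N ==> vlt (v i) (v j)]
  && ([set v i | i : 'I_k.+1] \in simplices X).

Record simplex (X : lo_complex) (k : nat) := Simplex {
  simplex_vtx :> {ffun 'I_k.+1 -> X};
  simplexP : is_simplex simplex_vtx
}.
HB.instance Definition _ X k := [isSub for @simplex_vtx X k].
HB.instance Definition _ X k := [Finite of @simplex X k by <:].

Definition origin X k (s : simplex X k) : X := s ord0.
Definition final X k (s : simplex X k) : X := s ord_max.

Fact subsimplex_subproof X m n (s : simplex X n) (h : 'I_m.+1 -> 'I_n.+1) :
  {homo h : i j / (i < j)%N} -> is_simplex [ffun i => s (h i)].
Proof.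
case: s => v /= /andP[/forallP v_lt v_in] h_lt; apply/andP; split.
  apply/forallP => i; apply/forallP => j; apply/implyP => ij.
  by rewrite !ffunE; apply: (implyP (forallP (v_lt _) _)); apply: h_lt.
apply: (simplices_sub v_in).
  by apply/subsetP => x /imsetP[i _ ->]; rewrite ffunE imset_f.
by apply/set0Pn; exists (v (h ord0)); apply/imsetP; exists ord0; rewrite ?ffunE.
Qed.

Definition subsimplex X m n (s : simplex X n) (h : 'I_m.+1 -> 'I_n.+1)
    (h_lt : {homo h : i j / (i < j)%N}) : simplex X m :=
  Simplex (subsimplex_subproof s h_lt).

Fact lift_lt n (i : 'I_n.+1) : {homo lift i : j j' / (j < j')%N}.
Proof. by move=> j j' jj' /=; rewrite ltnNge leq_bump2 -ltnNge. Qed.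
Fact front_lt k l :
  {homo @widen_ord k.+1 (k + l).+1 (leq_addr l k) : i j / (i < j)%N}.
Proof. by []. Qed.
Fact back_lt k l :
  {homo (fun i : 'I_l.+1 => cast_ord (addnS k l) (rshift k i))
    : i j / (i < j)%N}.
Proof. by move=> i j ij /=; rewrite ltn_add2l. Qed.

(* [0, ..., ^i, ..., k+1] *)
Definition face X k (s : simplex X k.+1) (i : 'I_k.+2) : simplex X k :=
  subsimplex s (@lift_lt k.+1 i).
(* [0, ..., k] in [0, ..., k+l] *)
Definition front X k l (s : simplex X (k + l)) : simplex X k :=
  subsimplex s (@front_lt k l).
(* [k, ..., k+l] in [0, ..., k+l] *)
Definition back X k l (s : simplex X (k + l)) : simplex X l :=
  subsimplex s (@back_lt k l).

Fact origin_face X k (s : simplex X k.+1) (i : 'I_k.+1) :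
  origin (face s (lift ord0 i)) = origin s.
Proof. by rewrite /origin ffunE; congr (s _); apply: val_inj. Qed.
Fact origin_front X k l (s : simplex X (k + l)) : origin (front s) = origin s.
Proof. by rewrite /origin ffunE; congr (s _); apply: val_inj. Qed.
Fact origin_back X k l (s : simplex X (k + l)) :
  origin (back s) = final (front s).
Proof.
by rewrite /origin /final !ffunE; congr (s _); apply: val_inj; rewrite /= addn0.
Qed.
Definition edge (X : lo_complex) (i j : X) : bool :=
  (i != j) && ([set i; j] \in simplices X).

(* [par j i] is U_{ji} : E_i -> E_j; it is total for convenience, but only its
   values on edges are constrained, and only those are used below. *)
Record bundle (K : fieldType) (X : lo_complex) := Bundle {
  fib :> X -> vectType K;
  par : forall j i : X, 'Hom(fib i, fib j);
  parK : forall i j : X, edge i j -> (par i j \o par j i)%VF = \1%VF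
}.

(* Transport along an equality of vertices: the identity of a fibre. *)
Definition vcast K X (E : bundle K X) (i j : X) (e : i = j) : E i -> E j :=
  fun x => ecast v (E v) e x.
Definition hcast K X (E : bundle K X) (i j i' j' : X) (ei : i = i')
    (ej : j = j') (A : 'Hom(E i, E j)) : 'Hom(E i', E j') :=
  ecast v ('Hom(E i', E v)) ej (ecast v ('Hom(E v, E j)) ei A).

Section Cochains.
Variables (K : fieldType) (X : lo_complex) (E : bundle K X).

Definition cochain (k : nat) := {dffun forall s : simplex X k, E (origin s)}.
Definition hom_cochain (k : nat) :=
  {dffun forall s : simplex X k, 'Hom(E (final s), E (origin s))}.
HB.instance Definition _ k := GRing.Lmodule.on (cochain k).
HB.instance Definition _ k := GRing.Lmodule.on (hom_cochain k).

Definition cochain_cast (m n : nat) (e : m = n) (a : cochain m) : cochain n :=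
  ecast n (cochain n) e a.

(* The origin of [1, ..., k+1] is the vertex 1, so the first term is
   U_{01} <a, [1, ..., k+1]>. *)
Definition dnabla k (a : cochain k) : cochain k.+1 :=
  [ffun s : simplex X k.+1 =>
     par E (origin s) (origin (face s ord0)) (a (face s ord0))
     + \sum_(i < k.+1) (-1) ^+ i.+1 *:
         vcast (origin_face s i) (a (face s (lift ord0 i)))].

Definition hom_cup k l (B : hom_cochain k) (a : cochain l) : cochain (k + l) :=
  [ffun s : simplex X (k + l) =>
     vcast (origin_front s)
       (B (front s) (vcast (origin_back s) (a (back s))))].
End Cochains.

Definition rcochain (R : realType) (X : lo_complex) (l : nat) :=
  {ffun simplex X l -> R}.

Definition coboundary R X l (w : rcochain R X l) : rcochain R X l.+1 :=
  [ffun s => \sum_(i < l.+2) (-1) ^+ i * w (face s i)].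

Definition cup R g X (E : bundle (scalars R g) X) k l (a : cochain E k)
    (w : rcochain R X l) : cochain E (k + l) :=
  [ffun s : simplex X (k + l) =>
     of_real R g (w (back s)) *: vcast (origin_front s) (a (front s))].

Section HomDifferential.
Variables (K : fieldType) (X : lo_complex) (E : bundle K X).

(* The vertex of index i.+1 with i < k, and the last vertex k.+1. *)
Definition inner k (i : 'I_k) : 'I_k.+2 := lift ord0 (widen_ord (leqnSn k) i).

Fact origin_inner k (s : simplex X k.+1) (i : 'I_k) :
  origin (face s (inner i)) = origin s.
Proof. exact: origin_face. Qed.
Fact final_inner k (s : simplex X k.+1) (i : 'I_k) :
  final (face s (inner i)) = final s.
Proof.
by rewrite /final ffunE; congr (s _); apply: val_inj; rewrite /= /bump /= ltn_ord.
Qed.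
Fact final_face0 k (s : simplex X k.+1) : final (face s ord0) = final s.
Proof. by rewrite /final ffunE; congr (s _); apply: val_inj. Qed.
Fact origin_face_max k (s : simplex X k.+1) :
  origin (face s ord_max) = origin s.
Proof. by rewrite /origin ffunE; congr (s _); apply: val_inj. Qed.

(* The final vertex of [0, ..., k] is the vertex k, so the last term is
   (-1)^{k+1} <B, [0, ..., k]> U_{k,k+1}. *)
Definition dnabla_hom k (B : hom_cochain E k) : hom_cochain E k.+1 :=
  [ffun s : simplex X k.+1 =>
     (par E (origin s) (origin (face s ord0))
        \o hcast (final_face0 s) erefl (B (face s ord0)))%VF
     + \sum_(i < k) (-1) ^+ i.+1 *:
         hcast (final_inner s i) (origin_inner s i) (B (face s (inner i)))
     + (-1) ^+ k.+1 *:
         (hcast erefl (origin_face_max s) (B (face s ord_max))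
            \o par E (final (face s ord_max)) (final s))%VF].

Definition curvature : hom_cochain E 2 :=
  [ffun s : simplex X 2 =>
     (par E (origin s) (s 1) \o par E (s 1) (final s))%VF
     - par E (origin s) (final s)].
End HomDifferential.

Record smap (Y X : lo_complex) := Smap {
  smap_fun :> Y -> X;
  smap_simplices : forall s : {set Y}, s \in simplices Y ->
    smap_fun @: s \in simplices X;
  smap_le : {homo smap_fun : v w / vle v w}
}.

Section Pullback.
Variables (Y X : lo_complex) (f : smap Y X).

Section PullbackBundle.
Variables (K : fieldType) (E : bundle K X).

Definition pull_par (j i : Y) : 'Hom(E (f i), E (f j)) :=
  match f i =P f j with
  | ReflectT e => hcast erefl e \1%VF
  | ReflectF _ => par E (f j) (f i)
  end.

Fact pull_parK (i j : Y) :
  edge i j -> (pull_par i j \o pull_par j i)%VF = \1%VF.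
Proof.
move=> /andP[_ ij]; rewrite /pull_par.
case: eqP => [e|ne]; case: eqP => [e'|ne'] //=.
- move: (e) e'; rewrite /hcast; case: _ / e => e e'.
  by rewrite (eq_irrelevance e erefl) (eq_irrelevance e' erefl) /= comp_lfun1l.
- by case: ne'; rewrite e.
- by case: ne; rewrite e'.
apply: parK; rewrite /edge; apply/andP; split; first by apply/eqP.
by have := smap_simplices f ij; rewrite imsetU1 imset_set1.
Qed.

Definition pull_bundle : bundle K Y :=
  @Bundle K Y (fun i => E (f i)) pull_par pull_parK.

Definition smap_vtx k (s : simplex Y k) : {ffun 'I_k.+1 -> X} :=
  [ffun i => f (s i)].

Fact origin_smap k (s : simplex Y k) (p : is_simplex (smap_vtx s)) :
  origin (Simplex p) = f (origin s).
Proof. by rewrite /origin ffunE. Qed.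

(* The image of [0, ..., k] is always a simplex of X, and since f preserves the
   order, it is a k-simplex exactly when f(0), ..., f(k) is the increasing list
   of vertices of a k-simplex. *)
Definition pull k (a : cochain E k) : cochain pull_bundle k :=
  [ffun s : simplex Y k =>
     match @idP (is_simplex (smap_vtx s)) with
     | ReflectT p => vcast (origin_smap p) (a (Simplex p))
     | ReflectF _ => 0
     end : pull_bundle (origin s)].
End PullbackBundle.

Definition rpull R k (w : rcochain R X k) : rcochain R Y k :=
  [ffun s : simplex Y k =>
     (match @idP (is_simplex (smap_vtx s)) with
      | ReflectT p => w (Simplex p)
      | ReflectF _ => 0
      end : R)].
End Pullback.

(* Main.v *)
Require Import Defs.
From HB Require Import structures.
From mathcomp Require Import all_boot all_order all_algebra.
From mathcomp Require Import reals complex.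
From mathcomp Require Import zify.
Import GRing.Theory.
Local Open Scope ring_scope.

(** The idea is to fix a vertex v and to carry every value of a cochain to the
    single fibre over v.  Let T_{vw} be U_{vw} for v <> w and the identity for
    v = w, and for a cochain a let a_v be the E_v-valued function
    s |-> T_{v,s_0} <a, s>.  Only the face that omits the vertex 0 changes the
    origin, so the covariant derivative is an ordinary coboundary with values
    in the fibre over the origin of the simplex at hand:
      <d_nabla a, s> = (delta a_v)(s)   with v = s_0   ([dnablaE]).
    Cup products and pullbacks also commute with a |-> a_v ([along_cup],
    [along_pull]); for pullbacks this is because the transport of the pullback
    bundle, which is the identity on collapsed edges, is T_{f(v) f(w)}
    ([transport_pull]).  The Leibniz rule and naturality thus follow from the
    corresponding facts about cochains with values in one fixed vector space
    ([delta_cup], [pullval_cup], [pullval_delta]).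

    For the curvature, T can fail to be multiplicative only along three distinct
    vertices.  Expanding d_nabla d_nabla a on [0, ..., k+2] therefore gives
    delta (delta a_0), which vanishes ([delta_delta]), apart from the single
    term which passes through the vertices 2, 1, 0 in turn.  There
    U_01 U_12 stands in place of U_02, and the discrepancy is F applied to the
    value of a on [2, ..., k+2].

    The Bianchi identity is the cancellation, in pairs, of the terms of
      U_01 (U_12 U_23 - U_13) - (U_02 U_23 - U_03) + (U_01 U_13 - U_03)
        - (U_01 U_12 - U_02) U_23. *)

(** * Simplices and their faces *)

Section Simplices.
Set Implicit Arguments.
Unset Strict Implicit.
Variable X : lo_complex.

Lemma simplex_lt k (s : simplex X k) (i j : 'I_k.+1) :
  (i < j)%N -> vlt (s i) (s j).
Proof.
by case: s => v /= /andP[/forallP v_lt _]; apply/implyP/(forallP (v_lt i)).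
Qed.

Lemma simplex_neq k (s : simplex X k) (i j : 'I_k.+1) :
  (i < j)%N -> s i != s j.
Proof. by move=> /(simplex_lt s)/andP[]. Qed.

Lemma simplex_le k (s : simplex X k) (i j : 'I_k.+1) :
  (i <= j)%N -> vle (s i) (s j).
Proof.
rewrite leq_eqVlt => /orP[/eqP/val_inj -> | /(simplex_lt s)/andP[]//].
exact: vle_refl.
Qed.

Lemma simplex_ext k (s t : simplex X k) : s =1 t -> s = t.
Proof. by move=> st; apply/val_inj/ffunP. Qed.

(** The simplicial identity, with the indices tied by their values only, so that
    any choice of ordinals can be used. *)
Lemma face_face k (s : simplex X k.+2) (i : 'I_k.+3) (j : 'I_k.+2)
    (i' : 'I_k.+2) (j' : 'I_k.+3) :
  i' = i :> nat -> j' = j.+1 :> nat -> (i <= j)%N ->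
  face (face s i) j = face (face s j') i'.
Proof.
move=> ei ej ij; apply: simplex_ext => m; rewrite !ffunE.
by congr (s _); apply: val_inj; rewrite /= ei ej /bump; lia.
Qed.

(** The dimensions (k + l).+1 and k + l.+1 are equal but not convertible, so the
    second summand of the Leibniz rule lives on a cast simplex. *)
Definition simplex_cast m n (e : m = n) (s : simplex X n) : simplex X m :=
  ecast n (simplex X n) (esym e) s.

Lemma simplex_castE m n (e : m = n) (s : simplex X n) (i : 'I_m.+1)
    (j : 'I_n.+1) :
  i = j :> nat -> simplex_cast e s i = s j.
Proof. by move: s j; case: _ / e => s j /val_inj->. Qed.
End Simplices.

(** * Cochains with values in a fixed vector space *)

Section Untwisted.
Set Implicit Arguments.
Unset Strict Implicit.
Variables (K : fieldType) (X : lo_complex).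

Definition delta (V : lmodType K) k (G : simplex X k -> V)
    (s : simplex X k.+1) : V :=
  \sum_(i < k.+2) (-1) ^+ i *: G (face s i).

Definition mixed_cup (V : lmodType K) k l (G : simplex X k -> V)
    (w : simplex X l -> K^o) (s : simplex X (k + l)) : V :=
  w (back s) *: G (front s).

Lemma eq_delta (V : lmodType K) k (G H : simplex X k -> V) s :
  G =1 H -> delta G s = delta H s.
Proof. by move=> GH; apply: eq_bigr => i _; rewrite GH. Qed.

(** In the double sum, the pair (i, j) with i <= j and the pair (j+1, i) omit
    the same two vertices, and their signs are opposite. *)
Lemma delta_delta (V : lmodType K) k (G : simplex X k -> V) s :
  delta (delta G) s = 0.
Proof.
rewrite /delta; under eq_bigr do rewrite scaler_sumr.
rewrite pair_big /= (bigID (fun p : 'I_k.+3 * 'I_k.+2 => (p.1 <= p.2)%N)) /=.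
rewrite [X in _ + X](reindex_onto
  (fun p : 'I_k.+3 * 'I_k.+2 => (lift ord0 p.2, inord p.1 : 'I_k.+2))
  (fun p : 'I_k.+3 * 'I_k.+2 => (inord p.2 : 'I_k.+3, inord p.1.-1 : 'I_k.+2)))
  /=; last first.
  move=> [i j] /=; rewrite -ltnNge => ji.
  have ? := ltn_ord i; have ? := ltn_ord j.
  by congr pair; apply: val_inj; rewrite /= /bump ?inordK //=; lia.
apply/eqP; rewrite addr_eq0 -sumrN; apply/eqP.
apply: eq_big => [[i j]|[i j] /= ij] /=.
  have ? := ltn_ord i; have ? := ltn_ord j.
  apply/idP/andP => [ij | [+ /eqP[+ _]]].
    split; first by rewrite inordK /bump /=; lia.
    by apply/eqP; congr pair; apply: val_inj; rewrite /= /bump !inordK //=; lia.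
  (* For i = k+2 the value of [inord i] is a default one, smaller than i, and
     the round trip through the reindexing does not return i. *)
  have ik := ltn_ord (inord i : 'I_k.+2).
  move=> + /(congr1 val); rewrite /= /bump [X in X = _]inordK; last by lia.
  by move=> + ei; rewrite ei; lia.
have ? := ltn_ord i; have ? := ltn_ord j.
have ei : (inord i : 'I_k.+2) = i :> nat by rewrite inordK //; lia.
rewrite (@face_face _ _ s i j (inord i) (lift ord0 j)) //.
by rewrite !scalerA -scaleNr ei /= /bump /= exprS mulN1r mulNr opprK mulrC.
Qed.

Lemma sum_cast_ord (V : zmodType) m n (e : m = n) (F : 'I_n -> V) :
  \sum_(i < n) F i = \sum_(i < m) F (cast_ord e i).
Proof.
by move: F; case: _ / e => F; apply: eq_bigr => i _; rewrite cast_ord_id.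
Qed.

(** A face omitting a vertex i <= k alters only the front part, and one omitting
    a vertex i > k only the back part.  The right-hand side has two further
    terms: the last face of the front [0, ..., k+1] and the face 0 of the back
    [k, ..., k+l+1].  Both are the product of the values on [0, ..., k] and
    [k+1, ..., k+l+1], with opposite signs. *)
Lemma delta_cup (V : lmodType K) k l (G : simplex X k -> V)
    (w : simplex X l -> K^o) (s : simplex X (k + l).+1) :
  delta (mixed_cup G w) s =
  mixed_cup (delta G) w (s : simplex X (k.+1 + l))
  + (-1) ^+ k *: mixed_cup G (delta w) (simplex_cast (addnS k l) s).
Proof.
rewrite {2 3}/mixed_cup {2 3}/delta.
have front_max : face (front (s : simplex X (k.+1 + l))) ord_max
    = front (simplex_cast (addnS k l) s).
  apply: simplex_ext => i; rewrite !ffunE.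
  by apply/esym/simplex_castE; rewrite /= /bump; have := ltn_ord i; lia.
have back_min : face (back (simplex_cast (addnS k l) s)) ord0
    = back (s : simplex X (k.+1 + l)).
  apply: simplex_ext => i; rewrite !ffunE.
  by apply/simplex_castE; rewrite /= /bump; lia.
rewrite [\sum_(i < k.+2) _]big_ord_recr [\sum_(i < l.+2) _]big_ord_recl /=.
rewrite front_max back_min [_ *: (_ + _)]scalerDr !scaler_sumr.
rewrite [(_ + _) *: G _]scalerDl scalerDr [(-1) ^+ 0 *: _]scale1r.
(* The two further terms cancel here. *)
rewrite [w _ *: ((-1) ^+ _ *: _)]scalerA [w _ * _]mulrC -scalerA.
rewrite exprS mulN1r scaleNr -addrA addKr.
rewrite /delta (sum_cast_ord (addnS k.+1 l)) big_split_ord /=.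
congr (_ + _).
  apply: eq_bigr => i _; rewrite /mixed_cup !scalerA [w _ * _]mulrC.
  have ? := ltn_ord i.
  congr (_ * w _ *: G _); apply: simplex_ext => j; rewrite !ffunE; congr (s _);
    by apply: val_inj; rewrite /= /bump; lia.
rewrite scaler_suml scaler_sumr; apply: eq_bigr => i _.
rewrite /mixed_cup !scalerA mulrA -exprD.
have -> : (k + lift ord0 i = k.+1 + i)%N by rewrite /= /bump; lia.
congr (_ * w _ *: G _); apply: simplex_ext => j; rewrite !ffunE;
  by apply/esym/simplex_castE; rewrite /= /bump; have := ltn_ord j; lia.
Qed.
End Untwisted.

(** * Pullback of cochains with values in a fixed vector space *)

Section UntwistedPullback.
Set Implicit Arguments.
Unset Strict Implicit.
Variables (K : fieldType) (X Y : lo_complex) (f : smap Y X).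

(** [insub] returns the image of s as a k-simplex when it is one, which avoids
    dependent matching on the proof. *)
Definition pullval (V : lmodType K) k (G : simplex X k -> V)
    (s : simplex Y k) : V :=
  oapp G 0 (insub (smap_vtx f s)).

(** Since f is simplicial and order preserving, the image of s can fail to be a
    k-simplex only by a coincidence of vertices. *)
Lemma is_simplex_smap k (s : simplex Y k) :
  is_simplex (smap_vtx f s) =
  [forall i : 'I_k.+1, forall j : 'I_k.+1, (i < j)%N ==> (f (s i) != f (s j))].
Proof.
rewrite /is_simplex andbC.
have -> : [set smap_vtx f s i | i : 'I_k.+1] \in simplices X.
  have -> : [set smap_vtx f s i | i : 'I_k.+1] = f @: [set s i | i : 'I_k.+1].
    by rewrite -imset_comp; apply: eq_imset => i; rewrite /= ffunE.
  by case/andP: (simplexP s) => _; apply: smap_simplices.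
rewrite andTb; apply: eq_forallb => i; apply: eq_forallb => j.
apply: implyb_id2l => ij.
by rewrite !ffunE /vlt (smap_le f (simplex_le s (ltnW ij))) andbT.
Qed.

(** Monotonicity and antisymmetry: f cannot identify two vertices without
    collapsing everything between them. *)
Lemma smap_between k (s : simplex Y k) (i m j : 'I_k.+1) :
  (i <= m <= j)%N -> f (s i) = f (s j) -> f (s m) = f (s i).
Proof.
move=> /andP[im mj] fij; apply: (@vle_anti X).
rewrite (smap_le f (simplex_le s im)) andbT fij.
exact: (smap_le f (simplex_le s mj)).
Qed.

(** By [smap_between] a degenerate simplex has a collapsed edge between
    consecutive vertices; such an edge lies either in the front or in the back
    of s, and it survives in all but two of the faces of s. *)
Lemma degenerate_smap k (s : simplex Y k) :
  ~~ is_simplex (smap_vtx f s) ->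
  exists i : 'I_k, f (s (widen_ord (leqnSn k) i)) = f (s (lift ord0 i)).
Proof.
rewrite is_simplex_smap => /forallPn[i /forallPn[j]].
rewrite negb_imply negbK => /andP[ij /eqP fij].
have ik : (i < k)%N by have := ltn_ord j; lia.
exists (Ordinal ik).
have -> : widen_ord (leqnSn k) (Ordinal ik) = i by apply: val_inj.
by apply/esym/(smap_between _ fij); rewrite /= /bump; lia.
Qed.

Lemma pullval_simplex (V : lmodType K) k (G : simplex X k -> V)
    (s : simplex Y k) (u : simplex X k) :
  (forall i, u i = f (s i)) -> pullval G s = G u.
Proof.
move=> us; rewrite /pullval; have -> : smap_vtx f s = val u.
  by apply/ffunP => i; rewrite ffunE -us.
by rewrite valK.
Qed.

Lemma eq_pullval (V : lmodType K) k (G H : simplex X k -> V) s :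
  G =1 H -> pullval G s = pullval H s.
Proof. by move=> GH; rewrite /pullval; case: insub. Qed.

Lemma pullval_degenerate (V : lmodType K) k (G : simplex X k -> V)
    (s : simplex Y k) (i j : 'I_k.+1) :
  (i < j)%N -> f (s i) = f (s j) -> pullval G s = 0.
Proof.
move=> ij fij; rewrite /pullval insubF //; apply/negbTE.
rewrite is_simplex_smap negb_forall; apply/existsP; exists i.
by rewrite negb_forall; apply/existsP; exists j; rewrite ij fij eqxx.
Qed.

Lemma pullval_cup (V : lmodType K) k l (G : simplex X k -> V)
    (w : simplex X l -> K^o) (s : simplex Y (k + l)) :
  pullval (mixed_cup G w) s = mixed_cup (pullval G) (pullval w) s.
Proof.
rewrite /mixed_cup; have [p | /degenerate_smap[i fi]] :=
  boolP (is_simplex (smap_vtx f s)).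
  have pE j : Simplex p j = f (s j) by rewrite ffunE.
  rewrite (pullval_simplex _ pE).
  rewrite (@pullval_simplex _ _ w _ (back (Simplex p))); last first.
    by move=> j; rewrite !ffunE.
  rewrite (@pullval_simplex _ _ G _ (front (Simplex p))) //.
  by move=> j; rewrite !ffunE.
have ikl := ltn_ord i; rewrite (pullval_degenerate _ _ fi); last by [].
have [ik | ki] := ltnP i k.
  rewrite (@pullval_degenerate _ _ G _ (inord i) (inord i.+1)) ?scaler0 //.
    by rewrite !inordK //; lia.
  rewrite !ffunE; move: fi; congr (f (s _) = f (s _));
    by apply: val_inj; rewrite /= /bump inordK //; lia.
rewrite (@pullval_degenerate _ _ w _ (inord (i - k)) (inord (i - k).+1))
  ?scale0r //.
  by rewrite !inordK //; lia.
rewrite !ffunE; move: fi; congr (f (s _) = f (s _));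
  by apply: val_inj; rewrite /= /bump inordK //; lia.
Qed.

(** If f collapses the edge [i, i+1] of s, every face other than the faces i and
    i+1 contains this edge and contributes 0, while these two have the same
    image and opposite signs. *)
Lemma pullval_delta (V : lmodType K) k (G : simplex X k -> V)
    (s : simplex Y k.+1) :
  pullval (delta G) s = delta (pullval G) s.
Proof.
rewrite /delta; have [p | /degenerate_smap[i fi]] :=
  boolP (is_simplex (smap_vtx f s)).
  have pE j : Simplex p j = f (s j) by rewrite ffunE.
  rewrite (pullval_simplex _ pE); apply: eq_bigr => i _.
  rewrite (@pullval_simplex _ _ G _ (face (Simplex p) i)) //.
  by move=> j; rewrite !ffunE.
rewrite (pullval_degenerate _ _ fi); last by [].
set i0 := widen_ord _ i in fi; set i1 := lift ord0 i in fi.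
have i01 : i1 != i0 by apply/eqP => /(congr1 val); rewrite /= /bump; lia.
rewrite (bigD1 i0) //= (bigD1 i1) //= big1 ?addr0.
  have -> : pullval G (face s i1) = pullval G (face s i0).
    rewrite /pullval; congr (oapp _ _ (insub _)); apply/ffunP => j.
    rewrite !ffunE; have [ji|ji|ji] := ltngtP j i.
    - by congr (f (s _)); apply: val_inj; rewrite /= /bump; lia.
    - by congr (f (s _)); apply: val_inj; rewrite /= /bump; lia.
    - have -> : lift i1 j = i0 by apply: val_inj; rewrite /= /bump; lia.
      have -> : lift i0 j = i1 by apply: val_inj; rewrite /= /bump; lia.
      exact: fi.
  by rewrite /= /bump /= exprS mulN1r scaleNr addrN.
move=> m /andP[m0 m1].
(* The vertices i and i+1 of s have positions [unbump m i] and [unbump m i.+1]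
   in its face m. *)
have Hm0 : (m : nat) <> i by move=> e; case/eqP: m0; apply: val_inj.
have Hm1 : (m : nat) <> i.+1 by move=> e; case/eqP: m1; apply: val_inj.
have ? := ltn_ord i; have ? := ltn_ord m.
have u0 : (unbump m i0 < k.+1)%N by rewrite /unbump /=; lia.
have u1 : (unbump m i1 < k.+1)%N by rewrite /unbump /= /bump; lia.
rewrite (@pullval_degenerate _ _ G _ (Ordinal u0) (Ordinal u1)) ?scaler0 //.
  by rewrite /= /unbump /= /bump; lia.
rewrite !ffunE; move: fi; congr (f (s _) = f (s _));
  by apply: val_inj; rewrite /= /bump /unbump /= /bump; lia.
Qed.
End UntwistedPullback.

(** * The covariant derivative as a coboundary, and its curvature *)

Section Transport.
Set Implicit Arguments.
Unset Strict Implicit.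
Variables (K : fieldType) (X : lo_complex) (E : bundle K X).

(** The map T_{vw}.  Making it the identity on a single fibre, where [par] is
    unconstrained, lets one formula cover parallel transport, [vcast] and the
    transport of a pullback bundle. *)
Definition transport (v w : X) : 'Hom(E w, E v) :=
  match w =P v with
  | ReflectT e => hcast erefl e \1%VF
  | ReflectF _ => par E v w
  end.

Lemma transport_refl v : transport v v = \1%VF.
Proof.
by rewrite /transport; case: eqP => // e; rewrite (eq_irrelevance e erefl).
Qed.

Lemma transport_id v x : transport v v x = x.
Proof. by rewrite transport_refl id_lfunE. Qed.

Lemma transport_par v w : v != w -> transport v w = par E v w.
Proof. by rewrite /transport eq_sym; case: eqP. Qed.

Lemma vcastE v w (e : w = v) (x : E w) : vcast e x = transport v w x.
Proof. by move: e x; case: v / => x; rewrite transport_id. Qed.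

Definition along k (a : cochain E k) (v : X) (s : simplex X k) : E v :=
  transport v (origin s) (a s).

Lemma along_origin k (a : cochain E k) s : along a (origin s) s = a s.
Proof. exact: transport_id. Qed.

(** T composes when one of the two factors is an identity, whatever the
    curvature. *)
Lemma transport_along k (a : cochain E k) u v s :
  u = v \/ v = origin s -> transport u v (along a v s) = along a u s.
Proof. by case=> ->; rewrite ?transport_id ?along_origin. Qed.

(** The face 0 is the only one whose origin is not that of s; on the others T is
    a mere identification of equal fibres. *)
Lemma dnablaE k (a : cochain E k) s :
  dnabla a s = delta (along a (origin s)) s.
Proof.
rewrite ffunE /delta [RHS]big_ord_recl [_ ^+ ord0 *: _]scale1r; congr (_ + _).
  rewrite /along transport_par //; rewrite /origin ffunE.
  exact: simplex_neq.
by apply: eq_bigr => i _; rewrite vcastE.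
Qed.

Lemma along_dnabla k (a : cochain E k) v s :
  v = origin s -> along (dnabla a) v s = delta (along a v) s.
Proof. by move=> ->; rewrite along_origin dnablaE. Qed.

Lemma along_cast m n (e : m = n) (a : cochain E m) v (s : simplex X n) :
  along (cochain_cast e a) v s = along a v (simplex_cast e s).
Proof. by move: s; case: _ / e. Qed.

(** In terms of a_v, the curvature measures the failure of a_v to be obtained
    from a_u by transport along the edge from u to v. *)
Lemma hom_cup_curvature k (a : cochain E k) (s : simplex X (2 + k)) :
  hom_cup (curvature E) a s =
  let b := face (face s ord0) ord0 in
  transport (origin s) (s 1) (along a (s 1) b) - along a (origin s) b.
Proof.
have s01 : origin s != s 1 by apply: simplex_neq.
have s12 : s 1 != s (inord 2) by apply: simplex_neq; rewrite inordK.
have s02 : origin s != s (inord 2) by apply: simplex_neq; rewrite inordK.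
have f1 : front s 1 = s 1 by rewrite ffunE; congr (s _); apply: val_inj.
have f2 : final (front s) = s (inord 2).
  by rewrite /final ffunE; congr (s _); apply: val_inj; rewrite /= inordK.
have -> : face (face s ord0) ord0 = back s.
  by apply: simplex_ext => i; rewrite !ffunE; congr (s _); apply: val_inj.
have bk : s (inord 2) = origin (back s) by rewrite origin_back f2.
rewrite ffunE !vcastE ffunE -/(along a _ (back s)) f1 f2 origin_front.
rewrite transport_id add_lfunE opp_lfunE comp_lfunE -!transport_par //.
have tE u : transport u (s (inord 2)) (along a (s (inord 2)) (back s))
    = along a u (back s) by apply: transport_along; right.
by rewrite !tE.
Qed.

(** Subtracting delta (delta a_v), which vanishes, leaves only the contribution
    of the face 0 of the face 0. *)
Lemma dnabla_dnabla k (a : cochain E k) :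
  dnabla (dnabla a) = hom_cup (curvature E) a.
Proof.
apply/ffunP => s; rewrite dnablaE hom_cup_curvature /=.
set v := origin s; set b := face (face s ord0) ord0.
have o1 : origin (face s ord0) = s 1.
  by rewrite /origin ffunE; congr (s _); apply: val_inj.
rewrite -[RHS]addr0 -(delta_delta (along a v) s) /delta.
rewrite big_ord_recl [X in _ = _ + X]big_ord_recl addrA.
congr (_ + _); last first.
  (* The faces of s other than the face 0 have origin v. *)
  apply: eq_bigr => i _; rewrite along_dnabla //.
  by rewrite origin_face.
rewrite !scale1r {1}/along dnablaE o1 /delta linear_sum /=.
rewrite big_ord_recl [X in _ = _ + X]big_ord_recl addrA !scale1r subrK.
congr (_ + _); apply: eq_bigr => i _; rewrite linearZ /= transport_along //.
by right; rewrite origin_face o1.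
Qed.

(** Once the casts are absorbed, the statement depends on vertices alone, and
    equalities between vertices of faces can be rewritten. *)
Lemma hcast_curvature (s : simplex X 2) v w (ew : final s = w)
    (ev : origin s = v) :
  hcast ew ev (curvature E s) = (par E v (s 1) \o par E (s 1) w)%VF - par E v w.
Proof. by case: _ / ew; case: _ / ev; rewrite ffunE. Qed.

Lemma bianchi : dnabla_hom (curvature E) = 0.
Proof.
apply/ffunP => s; rewrite ffunE [RHS]ffunE.
rewrite !big_ord_recl big_ord0 !hcast_curvature addr0.
have vtx (i : 'I_4) (j : 'I_3) (m : 'I_4) :
    m = lift i j :> nat -> face s i j = s m.
  by move=> e; rewrite ffunE; congr (s _); apply: val_inj.
pose s1 := s (inord 1); pose s2 := s (inord 2).
have e0 : origin (face s ord0) = s1 by apply: vtx; rewrite inordK.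
have e01 : face s ord0 1 = s2 by apply: vtx; rewrite inordK.
have e11 : face s (inner ord0) 1 = s2 by apply: vtx; rewrite inordK.
have e21 : face s (inner (lift ord0 ord0)) 1 = s1 by apply: vtx; rewrite inordK.
have e31 : face s ord_max 1 = s1 by apply: vtx; rewrite inordK.
have e32 : final (face s ord_max) = s2 by apply: vtx; rewrite inordK.
rewrite e0 e01 e11 e21 e31 e32.
apply/lfunP => x.
do !rewrite ?(add_lfunE, opp_lfunE, scale_lfunE, comp_lfunE, zero_lfunE).
rewrite linearB /= [_ ^+ 3]exprS [(-1) ^+ 2]sqrrN expr1n mulr1 expr1.
rewrite !scaleN1r scale1r !opprB [X in _ + X + _]addrC !subrKA.
exact: subrr.
Qed.
End Transport.

(** * Naturality *)

Section Pull.
Set Implicit Arguments.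
Unset Strict Implicit.
Variables (K : fieldType) (X Y : lo_complex) (f : smap Y X) (E : bundle K X).

(** A collapsed edge of Y maps to a single vertex, where T is the identity by
    definition: this is the case distinction in [pull_par]. *)
Lemma transport_pull (v w : Y) :
  transport (pull_bundle f E) v w = transport E (f v) (f w).
Proof.
rewrite {1}/transport; case: eqP => // e; case: v / e.
exact/esym/(transport_refl E (f w)).
Qed.

Lemma along_pull k (a : cochain E k) (v : Y) (s : simplex Y k) :
  along (pull f a) v s = pullval f (along a (f v)) s.
Proof.
rewrite {1}/along transport_pull ffunE.
case: {-}_ / (@idP (is_simplex (smap_vtx f s))) => p.
  rewrite (@pullval_simplex _ _ _ _ _ _ _ _ (Simplex p)); last first.
    by move=> i; rewrite ffunE.
  by rewrite vcastE; apply: (transport_along a); right; rewrite origin_smap.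
by rewrite linear0 /pullval insubF //; apply/negbTE/negP.
Qed.

(** On a degenerate simplex both sides vanish.  Elsewhere the image of s has
    origin f(s_0), so that [along_dnabla] applies to it. *)
Lemma pull_dnabla k (a : cochain E k) : pull f (dnabla a) = dnabla (pull f a).
Proof.
apply/ffunP => s; rewrite dnablaE -[LHS]along_origin along_pull.
rewrite (eq_delta _ (along_pull a (origin s))) -pullval_delta.
have [p | deg] := boolP (is_simplex (smap_vtx f s)); last first.
  by rewrite /pullval insubF //; apply/negbTE.
have pE i : Simplex p i = f (s i) by rewrite ffunE.
rewrite !(pullval_simplex _ pE) along_dnabla //.
by rewrite origin_smap.
Qed.
End Pull.

(** * Products with scalar cochains *)

Section Cup.
Set Implicit Arguments.
Unset Strict Implicit.
Variables (R : realType) (g : ground) (X : lo_complex).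

Definition scalar_val l (w : rcochain R X l) (s : simplex X l)
  : (scalars R g)^o := of_real R g (w s).

Lemma delta_scalar_val l (w : rcochain R X l) s :
  scalar_val (coboundary w) s = delta (scalar_val w) s.
Proof.
rewrite /scalar_val ffunE rmorph_sum; apply: eq_bigr => i _.
by rewrite rmorphM rmorph_sign.
Qed.

Variable E : bundle (scalars R g) X.

Lemma along_cup k l (a : cochain E k) (w : rcochain R X l) v s :
  along (cup a w) v s = mixed_cup (along a v) (scalar_val w) s.
Proof.
rewrite /along ffunE linearZ /= vcastE; congr (_ *: _).
by apply: transport_along; right; rewrite origin_front.
Qed.

Lemma dnabla_cup k l (a : cochain E k) (w : rcochain R X l) :
  dnabla (cup a w) = cup (dnabla a) w
    + (-1) ^+ k *: cochain_cast (addnS k l) (cup a (coboundary w)).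
Proof.
apply/ffunP => s; rewrite dnablaE (eq_delta _ (along_cup a w _)) delta_cup.
rewrite ffunE [X in _ = _ + X]ffunE; congr (_ + _ *: _).
  rewrite -[RHS](along_origin (cup (dnabla a) w)) along_cup /mixed_cup.
  by rewrite along_dnabla // origin_front.
rewrite -[RHS]along_origin along_cast along_cup /mixed_cup.
by rewrite delta_scalar_val.
Qed.
End Cup.

Section PullCup.
Set Implicit Arguments.
Unset Strict Implicit.
Variables (R : realType) (g : ground) (X Y : lo_complex) (f : smap Y X).
Variable E : bundle (scalars R g) X.

Lemma scalar_val_rpull l (w : rcochain R X l) s :
  scalar_val g (rpull f w) s = pullval f (scalar_val g w) s.
Proof.
rewrite /scalar_val ffunE.
case: {-}_ / (@idP (is_simplex (smap_vtx f s))) => p.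
  rewrite (@pullval_simplex _ _ _ _ _ _ _ _ (Simplex p)) // => i.
  by rewrite ffunE.
by rewrite rmorph0 /pullval insubF //; apply/negbTE/negP.
Qed.

Lemma pull_cup k l (a : cochain E k) (w : rcochain R X l) :
  pull f (cup a w) = cup (pull f a) (rpull f w).
Proof.
apply/ffunP => s; rewrite -[LHS]along_origin along_pull.
rewrite (eq_pullval _ _ (along_cup a w _)) pullval_cup.
rewrite -[RHS]along_origin along_cup /mixed_cup.
by rewrite along_pull scalar_val_rpull.
Qed.
End PullCup.

Theorem theorem1p5 (R : realType) (g : ground) (X Y : lo_complex)
    (E : bundle (scalars R g) X) (f : smap Y X) :
  (forall (k l : nat) (a : cochain E k) (w : rcochain R X l),
     dnabla (cup a w)
     = cup (dnabla a) w
       + (-1) ^+ k *: cochain_cast (addnS k l) (cup a (coboundary w)))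
  /\ (forall (k l : nat) (a : cochain E k) (w : rcochain R X l),
        pull f (cup a w) = cup (pull f a) (rpull f w))
  /\ (forall (k : nat) (a : cochain E k),
        pull f (dnabla a) = dnabla (pull f a))
  /\ (forall (k : nat) (a : cochain E k),
        dnabla (dnabla a) = hom_cup (curvature E) a)
  /\ dnabla_hom (curvature E) = 0.
Proof.
split; first exact: dnabla_cup.
split; first exact: pull_cup.
split; first exact: pull_dnabla.
split; first exact: dnabla_dnabla.
exact: bianchi.
Qed.
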